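(* Consider the one-hidden-layer ReLU model, the data model, the GD and SAM iterates, and assumptions (A1) and (A2) described in the context. Suppose $w_0=U_1U_1^Tw_0$ and $0\prec I-\eta D_1-\eta\rho D_1^2\prec I$, and let $u=U_1^T(\bar w-w_0)\in\mathbb{R}^r$. Then for $k\le\bar k$, $$\mathrm{Bias}^2(w_k^{\mathrm{SAM}})=\frac1n\sum_{i=1}^r(1-\eta d_i-\eta\rho d_i^2)^{2k}d_iu_i^2,$$ $$\mathrm{Var}(w_k^{\mathrm{SAM}})=\frac{\sigma^2}{n}\mathrm{Tr}\left(\left(I-(I-\eta D_1-\eta\rho D_1^2)^k\right)^2\right).$$ In particular, for $0\le k\le\bar k$ one has $\mathrm{Bias}^2(w_k^{\mathrm{SAM}})\le\mathrm{Bias}^2(w_k^{\mathrm{GD}})$ and $\mathrm{Var}(w_k^{\mathrm{SAM}})\ge\mathrm{Var}(w_k^{\mathrm{GD}})$.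
   Context: Data and noise: $n$ data points $(y_i,x_i)$, $x_i\in\mathbb{R}^d$, are given, with $y_i=y_i^*+\epsilon_i$, where $y_i^*$ is the true noiseless observation and the $\epsilon_i$ are independent zero-mean noise values with $\mathbb{E}[\epsilon\epsilon^T]=\sigma^2I$, $\epsilon=(\epsilon_1,\dots,\epsilon_n)$. Model: $\Phi(w;x)=\sum_{l=1}^L\max(0,x^Tw^{(l)})$ with $w=(w^{(1)},\dots,w^{(L)})\in\mathbb{R}^p$, $w^{(l)}\in\mathbb{R}^d$, $p=dL$. Define $a(w;x)=(a_1(w;x),\dots,a_L(w;x))\in\mathbb{R}^p$ with $a_l(w;x)=x$ if $x^Tw^{(l)}>0$ and $a_l(w;x)=0$ if $x^Tw^{(l)}\le0$; then $\Phi(w;x)=a(w;x)^Tw$. The loss is $f(w)=\frac12\sum_{i=1}^n(y_i-\Phi(w;x_i))^2$. Algorithms: with step size $\eta>0$, $\rho\ge0$ and a common initial point $w_0\in\mathbb{R}^p$: $w_{k+1}^{\mathrm{SAM}}=w_k^{\mathrm{SAM}}-\eta\nabla f(w_k^{\mathrm{SAM}}+\rho\nabla f(w_k^{\mathrm{SAM}}))$; GD is the same with $\rho=0$, i.e. $w_{k+1}^{\mathrm{GD}}=w_k^{\mathrm{GD}}-\eta\nabla f(w_k^{\mathrm{GD}})$. Assumptions. (A1) There exists $\bar k\ge1$ such that $a(w_k^{\mathrm{SAM}};x_i)=a(w_k^{\mathrm{GD}};x_i)=a(w_0;x_i)$ for all $0\le k\le\bar k$ and $i\in[n]$. (A2)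 There exists $\bar w\in\mathbb{R}^p$ such that $a(\bar w;x_i)=a(w_0;x_i)$ and $y_i^*=a(\bar w;x_i)^T\bar w$ for all $i\in[n]$. Notation: $A\in\mathbb{R}^{n\times p}$ has $i$-th row $a(w_0;x_i)^T$, rank $r$, and singular value decomposition $A=V\Sigma U^T$ with $V=[V_1\ V_2]$, $U=[U_1\ U_2]$, $\Sigma=\begin{bmatrix}\Sigma_1&0\\0&0\end{bmatrix}$, where the diagonal matrix $\Sigma_1\in\mathbb{R}^{r\times r}$ collects the nonzero singular values (so $A=V_1\Sigma_1U_1^T$). Put $D_1=\Sigma_1^2=\mathrm{diag}(d_1,\dots,d_r)$. $\prec$ is the Loewner order. For a (noise-dependent) $w$: $\mathrm{Bias}^2(w)=\frac1n\sum_{i=1}^n(y_i^*-\mathbb{E}_\epsilon[\Phi(w;x_i)])^2$ and $\mathrm{Var}(w)=\frac1n\mathbb{E}_\epsilon\left[\sum_{i=1}^n(\Phi(w;x_i)-\mathbb{E}_\epsilon[\Phi(w;x_i)])^2\right]$.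
   Formalization: Besides (A1), it is assumed that almost surely the SAM ascent points w_k^SAM + ρ∇f(w_k^SAM), k < k̄, also have the activation pattern of w_0 on all data; without this the claim is false. ∇f is taken with the convention ReLU'(0) = 0, and (A1) is required almost surely in the noise. *)

(* Defs.v *)
From HB Require Import structures.
From mathcomp Require Import all_boot all_order all_algebra.
From mathcomp Require Import all_classical all_reals all_analysis.

Set Implicit Arguments.
Unset Strict Implicit.
Unset Printing Implicit Defensive.

Import Order.TTheory GRing.Theory Num.Theory.
Import numFieldNormedType.Exports.

Local Open Scope classical_set_scope.
Local Open Scope ring_scope.

Definition dot (R : realType) (m : nat) (u v : 'cV[R]_m) : R :=
  (u^T *m v) 0 0.

(* The parameter space R^p, p = L * dim, is cut into L consecutive blocks of
   length dim; [neuron w l] is the l-th block w^(l). *)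
Definition neuron (R : realType) (L dim : nat) (w : 'cV[R]_(L * dim))
    (l : 'I_L) : 'cV[R]_dim :=
  (row l (vec_mx w^T))^T.

Definition Phi (R : realType) (L dim : nat) (w : 'cV[R]_(L * dim))
    (x : 'cV[R]_dim) : R :=
  \sum_(l < L) Num.max 0 (dot x (neuron w l)).

Definition act (R : realType) (L dim : nat) (w : 'cV[R]_(L * dim))
    (x : 'cV[R]_dim) : 'cV[R]_(L * dim) :=
  (mxvec (\matrix_(l < L) (if 0 < dot x (neuron w l) then x^T else 0)))^T.

Definition loss (R : realType) (L dim n : nat) (x : 'I_n -> 'cV[R]_dim)
    (y : 'I_n -> R) (w : 'cV[R]_(L * dim)) : R :=
  2^-1 * \sum_(i < n) (y i - Phi w (x i)) ^+ 2.

(* The gradient of [loss], with the convention ReLU'(0) = 0 that [act]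
   encodes. A convention is needed because [loss] is in general not
   differentiable where some x_i^T w^(l) vanishes. Everywhere else this is the
   Frechet gradient: see [diff_loss]. *)
Definition grad (R : realType) (L dim n : nat) (x : 'I_n -> 'cV[R]_dim)
    (y : 'I_n -> R) (w : 'cV[R]_(L * dim)) : 'cV[R]_(L * dim) :=
  - \sum_(i < n) (y i - Phi w (x i)) *: act w (x i).

Definition sam_ascent (R : realType) (L dim n : nat)
    (x : 'I_n -> 'cV[R]_dim) (y : 'I_n -> R) (rho : R)
    (w : 'cV[R]_(L * dim)) : 'cV[R]_(L * dim) :=
  w + rho *: grad x y w.

Definition sam (R : realType) (L dim n : nat) (x : 'I_n -> 'cV[R]_dim)
    (y : 'I_n -> R) (eta rho : R) (w0 : 'cV[R]_(L * dim)) (k : nat) :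
    'cV[R]_(L * dim) :=
  iter k (fun w => w - eta *: grad x y (sam_ascent x y rho w)) w0.

Definition gd (R : realType) (L dim n : nat) (x : 'I_n -> 'cV[R]_dim)
    (y : 'I_n -> R) (eta : R) (w0 : 'cV[R]_(L * dim)) (k : nat) :
    'cV[R]_(L * dim) :=
  iter k (fun w => w - eta *: grad x y w) w0.

Definition mutually_independent (disp : measure_display)
    (Omega : measurableType disp) (R : realType) (P : probability Omega R)
    (n : nat) (X : 'I_n -> {RV P >-> R}) : Prop :=
  forall (J : {set 'I_n}) (B : 'I_n -> set R),
    (forall i, measurable (B i)) ->
    P (\bigcap_(i in [set` J]) (X i @^-1` B i)) =
    (\prod_(i in J) P (X i @^-1` B i))%E.

Definition noisy (Omega : Type) (R : realType) (n : nat) (ystar : 'I_n -> R)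
    (eps : 'I_n -> Omega -> R) (om : Omega) : 'I_n -> R :=
  fun i => ystar i + eps i om.

(* The expectations are extended-real valued, so that no finiteness is
   presupposed. *)
Definition bias2 (disp : measure_display) (Omega : measurableType disp)
    (R : realType) (P : probability Omega R) (L dim n : nat)
    (x : 'I_n -> 'cV[R]_dim) (ystar : 'I_n -> R)
    (w : Omega -> 'cV[R]_(L * dim)) : \bar R :=
  ((n%:R^-1)%:E *
   \sum_(i < n) ((ystar i)%:E - 'E_P[fun om => Phi (w om) (x i)]) ^+ 2)%E.

(* As in the library's covariance, the inner expectation is read as a real
   number through [fine]. *)
Definition vari (disp : measure_display) (Omega : measurableType disp)
    (R : realType) (P : probability Omega R) (L dim n : nat)
    (x : 'I_n -> 'cV[R]_dim) (w : Omega -> 'cV[R]_(L * dim)) : \bar R :=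
  ((n%:R^-1)%:E *
   'E_P[fun om => (\sum_(i < n)
          (Phi (w om) (x i) - fine 'E_P[fun om' => Phi (w om') (x i)]) ^+ 2)%R])%E.

Definition loewner_lt (R : realType) (m : nat) (M N : 'M[R]_m) : Prop :=
  [/\ M^T = M, N^T = N &
      forall v : 'cV[R]_m, v != 0 -> 0 < dot v ((N - M) *m v)].

(* Full singular value decomposition A = V Sigma U^T with V = [V1 V2] and
   U = [U1 U2] orthogonal; the vector s lists the nonzero singular values.
   Being invertible, V and U are square, i.e. r + n2 = n and r + p2 = p. *)
Definition is_svd (R : realType) (n p r n2 p2 : nat) (A : 'M[R]_(n, p))
    (V1 : 'M[R]_(n, r)) (V2 : 'M[R]_(n, n2)) (s : 'rV[R]_r)
    (U1 : 'M[R]_(p, r)) (U2 : 'M[R]_(p, p2)) : Prop :=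
  let V := row_mx V1 V2 in
  let U := row_mx U1 U2 in
  [/\ V^T *m V = 1%:M /\ V *m V^T = 1%:M,
      U^T *m U = 1%:M /\ U *m U^T = 1%:M,
      forall i, 0 < s 0 i &
      A = V *m block_mx (diag_mx s) 0 0 0 *m U^T].

Lemma dotE (R : realType) (m : nat) (u v : 'cV[R]_m) :
  dot u v = \sum_(i < m) u i 0 * v i 0.
Proof. by rewrite /dot mxE; apply: eq_bigr => i _; rewrite mxE. Qed.

Lemma dot_act (R : realType) (L dim : nat) (w v : 'cV[R]_(L * dim))
    (x : 'cV[R]_dim) :
  dot (act w x) v =
  \sum_(l < L | 0 < dot x (neuron w l)) dot x (neuron v l).
Proof.
rewrite dotE (reindex _ (curry_mxvec_bij _ _)) /= [RHS]big_mkcond /=.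
transitivity (\sum_(l < L) \sum_(j < dim)
    act w x (mxvec_index l j) 0 * v (mxvec_index l j) 0).
  by rewrite pair_bigA /=; apply: eq_bigr => -[l j] _.
apply: eq_bigr => l _; rewrite /act.
case: ifPn => wl; last first.
  by apply: big1 => j _; rewrite mxE mxvecE mxE (negbTE wl) mxE mul0r.
rewrite dotE; apply: eq_bigr => j _.
by rewrite mxE mxvecE mxE wl !mxE.
Qed.

Lemma Phi_act (R : realType) (L dim : nat) (w : 'cV[R]_(L * dim))
    (x : 'cV[R]_dim) :
  Phi w x = dot (act w x) w.
Proof.
rewrite dot_act /Phi [RHS]big_mkcond /=; apply: eq_bigr => l _.
by case: ifPn => [/ltW/max_idPr//|]; rewrite -leNgt => /max_idPl.
Qed.

Lemma cvg_rsum (R : realType) (T : Type) (F : set_system T) (m : nat)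
    (f : 'I_m -> T -> R) (a : 'I_m -> R) {FF : Filter F} :
  (forall i, f i @ F --> a i) ->
  (fun t => \sum_(i < m) f i t) @ F --> \sum_(i < m) a i.
Proof.
move=> fa; apply: cvg_big => [|i _]; first exact: add_continuous.
exact: fa.
Qed.

Lemma continuous_dot (R : realType) (m : nat) (u : 'cV[R]_m) :
  continuous (dot u).
Proof.
move=> v; rewrite /continuous_at dotE.
rewrite (_ : dot u = fun v => \sum_(i < m) u i 0 * v i 0).
  apply: (@cvg_rsum _ _ (nbhs v)) => i.
  exact: (cvgM (cvg_cst _) (@coord_continuous R m 1 i 0 v)).
by apply/funext => z; rewrite dotE.
Qed.

Lemma is_diff_dot (R : realType) (m : nat) (u v : 'cV[R]_m) :
  is_diff v (dot u) (dot u).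
Proof.
have dot_lin : GRing.linear_for *:%R (dot u : 'cV[R]_m -> R^o).
  move=> a v1 v2; rewrite !dotE scaler_sumr -big_split; apply: eq_bigr => i _ /=.
  by rewrite !mxE mulrDr mulrCA.
pose f : {linear 'cV[R]_m -> R^o} :=
  HB.pack (dot u : 'cV[R]_m -> R^o)
    (GRing.isLinear.Build R 'cV[R]_m R^o *:%R (dot u) dot_lin).
have cf : continuous f := @continuous_dot R m u.
by split; [exact: (@linear_differentiable _ _ _ f)|exact: (@diff_lin _ _ _ f)].
Qed.

Lemma act_near (R : realType) (L dim n : nat) (x : 'I_n -> 'cV[R]_dim)
    (w : 'cV[R]_(L * dim)) :
  (forall i l, dot (x i) (neuron w l) != 0) ->
  \forall v \near w, forall i, act v (x i) = act w (x i).
Proof.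
move=> xw0; have neuronc (l : 'I_L) i :
    (fun v : 'cV[R]_(L * dim) => dot (x i) (neuron v l)) @ w -->
    dot (x i) (neuron w l).
  have E v : dot (x i) (neuron v l) =
      \sum_(j < dim) x i j 0 * v (mxvec_index l j) 0.
    by rewrite dotE; apply: eq_bigr => j _; rewrite !mxE.
  rewrite (_ : (fun v => _) = fun v : 'cV[R]_(L * dim) =>
      \sum_(j < dim) x i j 0 * v (mxvec_index l j) 0); last exact/funext.
  rewrite E; apply: (@cvg_rsum _ _ (nbhs w)) => j.
  exact: (cvgM (cvg_cst _) (@coord_continuous R _ 1 (mxvec_index l j) 0 w)).
suff H : forall i (l : 'I_L), \forall v \near w,
    (0 < dot (x i) (neuron v l)) = (0 < dot (x i) (neuron w l)).
  have {}H : \forall v \near w, forall i (l : 'I_L),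
      (0 < dot (x i) (neuron v l)) = (0 < dot (x i) (neuron w l)).
    apply: (@filter_forall _ _ _ (nbhs w)) => i.
    by apply: (@filter_forall _ _ _ (nbhs w)) => l; exact: H.
  apply: filterS H => v vw i; rewrite /act; congr (_ ^T); congr mxvec.
  by apply/matrixP => l j; rewrite !mxE vw.
move=> i l; have := xw0 i l; rewrite neq_lt => /orP[] xw.
- apply: (@filterS _ (nbhs w) _ _ _ _ (cvgr_lt _ (neuronc l i) _ xw)) => v vx.
  by rewrite (lt_gtF vx) (lt_gtF xw).
- apply: (@filterS _ (nbhs w) _ _ _ _ (cvgr_gt _ (neuronc l i) _ xw)) => v vx.
  by rewrite vx xw.
Qed.

Lemma near_eq_is_diff (R : realType) (V W : normedModType R)
    (f g df : V -> W) (a : V) :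
  (\forall z \near a, f z = g z) -> is_diff a f df -> is_diff a g df.
Proof.
move=> fg dfa; have fga : f a = g a by exact: nbhs_singleton fg.
have [cdf /eqaddoP dfo] := (diff_locallyP a f).1 (ex_diff (is_diff_def := dfa)).
have dgo : g \o shift a = cst (g a) + 'd f a +o_0 id.
  apply/eqaddoP => e e0; have := dfo e e0.
  have : \forall z \near (0 : V), f (z + a) = g (z + a).
    by have := fg; rewrite (near_shift 0) subr0.
  apply: filterS2 => z fgz.
  by rewrite !fctE /= -fgz -fga.
have dg := diff_unique cdf dgo.
split; last by rewrite dg diff_val.
by apply/diff_locallyP; rewrite dg.
Qed.

Lemma diff_loss (R : realType) (L dim n : nat) (x : 'I_n -> 'cV[R]_dim)
    (y : 'I_n -> R) (w : 'cV[R]_(L * dim)) :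
  (forall i l, dot (x i) (neuron w l) != 0) ->
  differentiable (loss x y) w /\
  'd (loss x y) w = dot (grad x y w) :> ('cV[R]_(L * dim) -> R).
Proof.
move=> xw0.
pose r i : 'cV[R]_(L * dim) -> R := cst (y i) - dot (act w (x i)).
pose g : 'cV[R]_(L * dim) -> R := 2^-1 *: \sum_(i < n) (r i) ^+ 2.
have gE v : g v = 2^-1 * \sum_(i < n) (y i - dot (act w (x i)) v) ^+ 2.
  by rewrite /g /= fct_sumE.
have dg : is_diff w g (dot (grad x y w)).
  have dr i : is_diff w (r i ^+ 2) ((2%:R * r i w) *: (- dot (act w (x i)))).
    have da := is_diff_dot (act w (x i)) w.
    apply: (@is_diff_eq _ _ _ _ (2%:R * r i w ^+ 1 *: (0 - dot (act w (x i))))).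
    by rewrite expr1 sub0r.
  have ds : is_diff w (\sum_(i < n) r i ^+ 2)
      (\sum_(i < n) (2%:R * r i w) *: (- dot (act w (x i)))).
    elim/big_ind2 : _ => // [|? ? ? ? ? ?]; first exact: is_diff_cst.
    exact: is_diffD.
  apply: is_diff_eq; apply/funext => v /=.
  rewrite fct_sumE /grad.
  rewrite /dot linearN mulNmx mxE linear_sum mulmx_suml summxE /=.
  rewrite -[LHS]/(2^-1 * \sum_(i < n)
    2%:R * r i w * - (dot (act w (x i)) v)) mulr_sumr -sumrN.
  apply: eq_bigr => i _; rewrite linearZ -scalemxAl mxE Phi_act.
  by rewrite !mulrN !mulrA mulVf ?mul1r.
have gl : \forall v \near w, g v = loss x y v.
  have := act_near xw0; apply: filterS => v vw; rewrite gE /loss.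
  by congr (_ * _); apply: eq_bigr => i _; rewrite Phi_act vw.
have dl := near_eq_is_diff gl dg.
by split; [exact: (ex_diff (is_diff_def := dl))|
           exact: (diff_val (is_diff_def := dl))].
Qed.

(* Main.v *)
(** On the event where the activation patterns are frozen, the residual
    [q_k = A w_k - y] satisfies [q_(k+1) = B q_k] with
    [B = I - eta K - eta rho K^2] and [K = A A^T]. Since [y = A wbar + eps], the
    prediction [A w_k] is therefore affine in the noise:
    [A w_k = A wbar + B^k A (w_0 - wbar) + (I - B^k) eps]. The SVD turns the
    offset into [- V1 M^k Sigma_1 u] and [I - B^k] into [V1 (I - M^k) V1^T],
    whose squared norms are the bias and the variance. GD is SAM with
    [rho = 0], and [0 < 1 - eta d_i - eta rho d_i^2 <= 1 - eta d_i < 1] gives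
    the comparison. *)

Require Import Defs.
From HB Require Import structures.
From mathcomp Require Import all_boot all_order all_algebra.
From mathcomp Require Import all_classical all_reals all_analysis.
From mathcomp Require Import measurable_realfun.

Set Implicit Arguments.
Unset Strict Implicit.
Unset Printing Implicit Defensive.

Import Order.TTheory GRing.Theory Num.Theory.
Import numFieldNormedType.Exports.

Local Open Scope classical_set_scope.
Local Open Scope ring_scope.

(** * Expectations of functions that agree almost surely *)

Section NonmeasurableIntegral.
Import HBNNSimple.

(* Setting a simple function below [f] to zero on the null set makes it lie
   below [g] without changing its integral, so the library's measurability
   assumptions, which the iterates would otherwise have to be shown to satisfy,
   are avoided. *)
Lemma ge0_le_integral_ae_eq (disp : measure_display)
    (T : measurableType disp) (R : realType) (mu : {measure set T -> \bar R})
    (f g : T -> \bar R) :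
  (forall t, 0 <= f t)%E -> (forall t, 0 <= g t)%E ->
  {ae mu, forall t, f t = g t} ->
  (\int[mu]_t f t <= \int[mu]_t g t)%E.
Proof.
move=> f0 g0 [N [mN muN fgN]].
rewrite ge0_integralTE// ge0_integralTE//.
apply: ge_ereal_sup => _ [h /= hf <-].
pose h' := proj_nnsfun h (measurableC mN).
have h'E t : h' t = (h \_ (~` N)) t by rewrite (mrestrict h (measurableC mN)).
have -> : sintegral mu h = sintegral mu h'.
  rewrite -!integralT_nnsfun; apply: ge0_ae_eq_integral => //.
  - exact/measurable_EFinP.
  - exact/measurable_EFinP.
  - by move=> t _; rewrite lee_fin.
  - by move=> t _; rewrite lee_fin.
  exists N; split => // t hh'; apply: contrapT => Nt; apply: hh' => _.
  by rewrite h'E patchE mem_set.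
apply: ereal_sup_ubound; exists h' => // t; rewrite h'E patchE.
have [|_] := boolP (t \in ~` N); last exact: g0.
rewrite inE => Nt; rewrite (le_trans (hf t))//.
suff -> : f t = g t by [].
by apply: contrapT => fgt; apply: Nt; exact: fgN.
Qed.

End NonmeasurableIntegral.

(** The comparison above is applied in both directions, separately to the positive and the negative
    parts. *)
Lemma expectation_ae_eq (disp : measure_display) (T : measurableType disp)
    (R : realType) (P : probability T R) (f g : T -> R) :
  {ae P, forall t, f t = g t} -> 'E_P[f]%E = 'E_P[g]%E.
Proof.
move=> fg; rewrite unlock [LHS]integralE [RHS]integralE.
have gf : {ae P, forall t, g t = f t} by apply: filterS fg.
congr (_ - _)%E; apply/eqP; rewrite eq_le; apply/andP; split;
  apply: ge0_le_integral_ae_eq => //;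
  [apply: filterS fg|apply: filterS gf|apply: filterS fg|apply: filterS gf];
  move=> t E;
  by rewrite ?funeposE ?funenegE E.
Qed.

(** * Moments of affine functions of the noise *)

Lemma expectation_affine (disp : measure_display) (T : measurableType disp)
    (R : realType) (P : probability T R) (I : finType) (X : I -> T -> R)
    (m a : I -> R) (c : R) :
  (forall i, X i \in Lfun P 1) -> (forall i, 'E_P[X i]%E = (m i)%:E) ->
  'E_P[fun t => (c + \sum_i a i * X i t)%R]%E = (c + \sum_i a i * m i)%:E.
Proof.
move=> X1 Xm.
have aX1 i : (a i \o* X i) \in Lfun P 1 by exact: Lfun_scale.
have -> : (fun t => c + \sum_i a i * X i t) =
    (cst c \+ \sum_i (a i \o* X i))%R.
  apply/funext => t /=; rewrite fct_sumE; congr (_ + _).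
  by apply: eq_bigr => i _ /=; rewrite mulrC.
rewrite expectationD ?Lfun_cst ?rpred_sum// expectation_cst EFinD.
congr (_ + _)%E.
rewrite -sumEFin.
rewrite -(big_map (fun i => a i \o* X i) xpredT id) expectation_sum; last first.
  by move=> _ /mapP[i _ ->].
rewrite big_map; apply: eq_bigr => i _.
by rewrite expectationZl// Xm EFinM.
Qed.

(** Expanding [(|X| - |Y|)^2 >= 0] bounds [|X Y|] by the integrable function [X^2 + Y^2]. *)
Lemma sqr_integrable_Lfun1_mul (disp : measure_display)
    (T : measurableType disp) (R : realType) (P : probability T R)
    (X Y : {RV P >-> R}) :
  ('E_P[(fun t => X t * X t)%R] < +oo)%E ->
  ('E_P[(fun t => Y t * Y t)%R] < +oo)%E ->
  (fun t => X t * Y t) \in Lfun P 1.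
Proof.
have sqr_int (Z : {RV P >-> R}) : ('E_P[(fun t => Z t * Z t)%R] < +oo)%E ->
    P.-integrable setT (fun t => (Z t * Z t)%:E).
  rewrite unlock => Zoo; apply/integrableP; split.
    by apply/measurable_EFinP; exact: measurable_funM.
  under eq_integral do rewrite gee0_abs ?lee_fin -?expr2 ?sqr_ge0//.
  by [].
move=> /sqr_int X2 /sqr_int Y2; apply/Lfun1_integrable.
apply: (@le_integrable _ _ _ _ _ measurableT _
    (fun t => (X t * X t)%:E + (Y t * Y t)%:E)%E).
- by apply/measurable_EFinP; exact: measurable_funM.
- move=> t _ /=; rewrite lee_fin [leRHS]ger0_norm ?addr_ge0 -?expr2 ?sqr_ge0//.
  rewrite normrM -(real_normK (num_real (X t))) -(real_normK (num_real (Y t))).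
  set a := `|X t|; set b := `|Y t|.
  have ab0 : 0 <= a * b by rewrite mulr_ge0 ?normr_ge0.
  have := sqr_ge0 (a - b); rewrite sqrrB addrAC subr_ge0 => /(le_trans _) -> //.
  by rewrite mulr2n lerDl.
exact: integrableD.
Qed.

(** The case [Y = 1] of the product bound: constants are square integrable because [P] has total
    mass one. *)
Lemma sqr_integrable_Lfun1 (disp : measure_display)
    (T : measurableType disp) (R : realType) (P : probability T R)
    (X : {RV P >-> R}) :
  ('E_P[(fun t => X t * X t)%R] < +oo)%E -> (X : T -> R) \in Lfun P 1.
Proof.
move=> X2; have := @sqr_integrable_Lfun1_mul _ _ _ P X (cst 1) X2.
rewrite (_ : (fun t => X t * _) = X); last first.
  by apply/funext => t /=; rewrite mulr1.
apply; rewrite (_ : (fun=> _) = cst (1 * 1)) ?expectation_cst ?ltry//.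
Qed.

(** Zero mean removes the noise from the expected prediction, so [b] is the whole bias. The centred
    prediction is [C eps], whose squared norm is the quadratic form of [C^T C] in [eps]; covariance
    [sigma^2 I] keeps only its diagonal. *)
Lemma bias2_vari_affine (disp : measure_display)
    (Omega : measurableType disp) (R : realType) (P : probability Omega R)
    (L dim n : nat) (x : 'I_n -> 'cV[R]_dim) (ystar : 'I_n -> R)
    (eps : 'I_n -> {RV P >-> R}) (sigma : R)
    (w : Omega -> 'cV[R]_(L * dim)) (b : 'cV[R]_n) (C : 'M[R]_n) :
  (forall i, 'E_P[eps i]%E = 0%:E) ->
  (forall i j,
     'E_P[(fun om => eps i om * eps j om)%R]%E = (sigma ^+ 2 *+ (i == j))%:E) ->
  {ae P, forall om, forall i,
     Phi (w om) (x i) = ystar i + b i 0 + (C *m \col_j eps j om) i 0} ->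
  bias2 P x ystar w = (n%:R^-1 * dot b b)%:E /\
  vari P x w = (sigma ^+ 2 / n%:R * \tr (C^T *m C))%:E.
Proof.
move=> mean0 cov PhiE.
have eps2 i : ('E_P[(fun om => eps i om * eps i om)%R] < +oo)%E.
  by rewrite cov ltry.
have EPhi i : 'E_P[fun om => Phi (w om) (x i)]%E = (ystar i + b i 0)%:E.
  transitivity 'E_P[fun om => (ystar i + b i 0 + \sum_j C i j * eps j om)%R]%E.
    apply: expectation_ae_eq; apply: filterS PhiE => om ->.
    by rewrite mxE; congr (_ + _); apply: eq_bigr => j _; rewrite mxE.
  rewrite (expectation_affine (m := fun=> 0)) ?big1 ?addr0//.
    by move=> j _; rewrite mulr0.
  by move=> j; exact: sqr_integrable_Lfun1.
split.
  rewrite /bias2 EFinM dotE -sumEFin; congr (_ * _)%E; apply: eq_bigr => i _.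
  by rewrite EPhi -EFinB -EFin_expe opprD addNKr sqrrN expr2.
rewrite /vari mulrAC mulrC EFinM; congr (_ * _)%E.
(* The quadratic form is linear in the products [eps_i eps_j], so [expectation_affine] applies
   again, now indexed by pairs and with the covariances as means. *)
transitivity 'E_P[fun om => (0 + \sum_(p : 'I_n * 'I_n)
    (C^T *m C) p.1 p.2 * (eps p.1 om * eps p.2 om))%R]%E.
  apply: expectation_ae_eq; apply: filterS PhiE => om om_Phi.
  under eq_bigr => i _.
    rewrite EPhi/= om_Phi addrC addKr mxE expr2 mulr_suml.
    under eq_bigr do rewrite mxE mulr_sumr.
    over.
  rewrite add0r exchange_big /=.
  under eq_bigr do rewrite exchange_big /=.
  rewrite pair_bigA /=; apply: eq_bigr => -[j l] _ /=.
  rewrite [X in _ = X * _]mxE mulr_suml; apply: eq_bigr => i _.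
  by rewrite !mxE mulrACA.
rewrite (expectation_affine (m := fun p => sigma ^+ 2 *+ (p.1 == p.2))).
- rewrite add0r /mxtrace mulr_sumr; congr EFin.
  rewrite -(pair_bigA _ (fun i j => (C^T *m C) i j * (sigma ^+ 2 *+ (i == j)))) /=.
  apply: eq_bigr => i _; rewrite (bigD1 i)//= big1 => [|j /negPf ji].
    by rewrite eqxx mulr1n addr0 mulrC.
  by rewrite eq_sym ji mulr0.
- by move=> p; exact: sqr_integrable_Lfun1_mul.
- by move=> p; exact: cov.
Qed.

(** * Gradient and residual dynamics under frozen activation patterns *)

Lemma grad_mx (R : realType) (L dim n : nat) (x : 'I_n -> 'cV[R]_dim)
    (y : 'I_n -> R) (w : 'cV[R]_(L * dim)) (A : 'M[R]_(n, L * dim)) :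
  A = \matrix_(i < n) (act w (x i))^T ->
  grad x y w = A^T *m (A *m w - \col_i y i).
Proof.
move=> AE; have PhiE i : Phi w (x i) = (A *m w) i 0.
  by rewrite Phi_act dotE mxE; apply: eq_bigr => j _; rewrite AE !mxE.
apply/matrixP => j k; rewrite /grad !mxE summxE -sumrN.
apply: eq_bigr => i _; rewrite ord1 PhiE AE !mxE.
by rewrite mulrC -mulrN opprB.
Qed.

Lemma gd_sam0 (R : realType) (L dim n : nat) (x : 'I_n -> 'cV[R]_dim)
    (y : 'I_n -> R) (eta : R) (w0 : 'cV[R]_(L * dim)) (k : nat) :
  gd x y eta w0 k = sam x y eta 0 w0 k.
Proof. by apply: eq_iter => w; rewrite /sam_ascent scale0r addr0. Qed.

(** Each step takes two gradients, at the iterate and at its ascent point. With both patterns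
    frozen, both are least-squares gradients for the same [A], so the residual evolves linearly. *)
Lemma residual_sam (R : realType) (L dim n : nat) (x : 'I_n -> 'cV[R]_dim)
    (y : 'I_n -> R) (eta rho : R) (w0 : 'cV[R]_(L * dim))
    (A : 'M[R]_(n, L * dim)) (k : nat) :
  A = \matrix_(i < n) (act w0 (x i))^T ->
  (forall j i, (j < k)%N ->
     act (sam x y eta rho w0 j) (x i) = act w0 (x i)) ->
  (forall j i, (j < k)%N ->
     act (sam_ascent x y rho (sam x y eta rho w0 j)) (x i) = act w0 (x i)) ->
  let K := A *m A^T in
  A *m sam x y eta rho w0 k - \col_i y i =
  (1%:M - eta *: K - (eta * rho) *: K ^+ 2) ^+ k *m (A *m w0 - \col_i y i).
Proof.
move=> AE + + K; set B := _ - _ - _.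
elim: k => [|k IH] actS actA; first by rewrite expr0 mul1mx.
rewrite exprS -mulmxA -IH; last 2 first.
  by move=> j i jk; apply: actS; exact: ltnW.
  by move=> j i jk; apply: actA; exact: ltnW.
rewrite {1}/sam iterS -/(sam x y eta rho w0 k); set w := sam _ _ _ _ _ k.
have gradA v : (forall i, act v (x i) = act w0 (x i)) ->
    grad x y v = A^T *m (A *m v - \col_i y i).
  move=> vw0; apply: grad_mx; rewrite AE.
  by apply/row_matrixP => i; rewrite !rowK vw0.
rewrite gradA; last by move=> i; exact: actA.
rewrite /sam_ascent gradA; last by move=> i; exact: actS.
set q := A *m w - _.
(* The ascent multiplies the residual by [I + rho K]; the descent then subtracts [eta K] times the
   result, which gives [B]. *)
have -> : A *m (w + rho *: (A^T *m q)) - \col_i y i = q + rho *: (K *m q).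
  by rewrite mulmxDr -scalemxAr mulmxA addrAC.
have -> : A *m (w - eta *: (A^T *m (q + rho *: (K *m q)))) - \col_i y i =
    q - eta *: (K *m (q + rho *: (K *m q))).
  by rewrite mulmxBr -scalemxAr mulmxA addrAC.
rewrite /B !mulmxBl mul1mx -!scalemxAl mulmxDr -scalemxAr.
by rewrite expr2 mulmxA scalerDr scalerA opprD addrA.
Qed.

(** * Diagonalising the propagator with the SVD *)

Lemma diag_mxX (R : pzSemiRingType) (r : nat) (a : 'rV[R]_r) (k : nat) :
  diag_mx a ^+ k = diag_mx (\row_i a 0 i ^+ k).
Proof.
elim: k => [|k IH].
  by rewrite expr0; apply/matrixP => i j; rewrite !mxE expr0.
rewrite exprS IH -[LHS]/(_ *m _) mulmx_diag; congr diag_mx.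
by apply/rowP => i; rewrite !mxE exprS.
Qed.

(** Test the quadratic form on the [i]-th basis vector. *)
Lemma loewner_lt_diag (R : realType) (m : nat) (M N : 'M[R]_m) (i : 'I_m) :
  loewner_lt M N -> M i i < N i i.
Proof.
move=> [_ _ /(_ (delta_mx i 0))] H.
rewrite -subr_gt0; have -> : N i i - M i i =
    dot (delta_mx i 0) ((N - M) *m delta_mx i 0).
  by rewrite /dot trmx_delta -colE -rowE !mxE.
apply: H; apply/eqP => /matrixP/(_ i 0); rewrite !mxE !eqxx /= => /eqP.
by rewrite oner_eq0.
Qed.

Section SVD.
Variables (R : realType) (n p r n2 p2 : nat) (A : 'M[R]_(n, p)).
Variables (V1 : 'M[R]_(n, r)) (V2 : 'M[R]_(n, n2)) (s : 'rV[R]_r).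
Variables (U1 : 'M[R]_(p, r)) (U2 : 'M[R]_(p, p2)).
Hypothesis svdA : is_svd A V1 V2 s U1 U2.

Lemma svd_V1_orthonormal : V1^T *m V1 = 1%:M.
Proof.
have [[+ _] _ _ _] := svdA; rewrite tr_row_mx mul_col_row scalar_mx_block.
by case/eq_block_mx.
Qed.

Lemma svd_V1_V2_orthogonal : V1^T *m V2 = 0.
Proof.
have [[+ _] _ _ _] := svdA; rewrite tr_row_mx mul_col_row.
by rewrite scalar_mx_block => /eq_block_mx[].
Qed.

Lemma svd_V_complete : V1 *m V1^T + V2 *m V2^T = 1%:M.
Proof. by have [[_ +] _ _ _] := svdA; rewrite tr_row_mx mul_row_col. Qed.

Lemma svd_U1_orthonormal : U1^T *m U1 = 1%:M.
Proof.
have [_ [+ _] _ _] := svdA; rewrite tr_row_mx mul_col_row scalar_mx_block.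
by case/eq_block_mx.
Qed.

Lemma svd_thin : A = V1 *m diag_mx s *m U1^T.
Proof.
have [_ _ _ ->] := svdA.
rewrite mul_row_block !mulmx0 !addr0 tr_row_mx mul_row_col mul0mx addr0.
by [].
Qed.

Variables (d : 'rV[R]_r) (eta rho : R).
Hypothesis hd : diag_mx s ^+ 2 = diag_mx d.

Let K := A *m A^T.
Let B := 1%:M - eta *: K - (eta * rho) *: K ^+ 2.
Let M := 1%:M - eta *: diag_mx d - (eta * rho) *: diag_mx d ^+ 2.

Lemma svd_gram : K = V1 *m diag_mx d *m V1^T.
Proof.
rewrite /K {2}svd_thin {1}svd_thin !trmx_mul trmxK tr_diag_mx !mulmxA.
rewrite -(mulmxA _ U1^T U1) svd_U1_orthonormal mulmx1 -hd expr2.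
by rewrite -(mulmxA V1).
Qed.

(** [B] is a polynomial in [K], and [V1] intertwines [K] with [diag_mx d]. *)
Lemma svd_propagator_V1 k : B ^+ k *m V1 = V1 *m M ^+ k.
Proof.
have KV : K *m V1 = V1 *m diag_mx d.
  by rewrite svd_gram -mulmxA svd_V1_orthonormal mulmx1.
have BV : B *m V1 = V1 *m M.
  rewrite /B /M !mulmxBl !mulmxBr mul1mx mulmx1 -!scalemxAl -!scalemxAr KV.
  by rewrite !expr2 -(mulmxA K) KV mulmxA KV mulmxA.
elim: k => [|k IH]; first by rewrite !expr0 mul1mx mulmx1.
by rewrite exprSr -[_ * B]/(_ *m B) -mulmxA BV mulmxA IH -mulmxA exprSr.
Qed.

(** The columns of [V2] lie in the kernel of [K], so residuals in these directions never move. *)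
Lemma svd_propagator_V2 k : B ^+ k *m V2 = V2.
Proof.
have KV : K *m V2 = 0 by rewrite svd_gram -mulmxA svd_V1_V2_orthogonal mulmx0.
have BV : B *m V2 = V2.
  rewrite /B !mulmxBl mul1mx -!scalemxAl expr2 -(mulmxA K) KV mulmx0.
  by rewrite !scaler0 !subr0.
elim: k => [|k IH]; first by rewrite !expr0 mul1mx.
by rewrite exprSr -[_ * B]/(_ *m B) -mulmxA BV.
Qed.

(** Insert [V1 V1^T + V2 V2^T = I]; the [V2] part cancels because [B ^+ k] fixes it. *)
Lemma svd_propagatorC k : 1%:M - B ^+ k = V1 *m (1%:M - M ^+ k) *m V1^T.
Proof.
transitivity ((1%:M - B ^+ k) *m (V1 *m V1^T + V2 *m V2^T)).
  by rewrite svd_V_complete mulmx1.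
rewrite mulmxDr !mulmxA !mulmxBl !mul1mx svd_propagator_V1 svd_propagator_V2.
by rewrite subrr addr0 mulmxBr mulmx1 mulmxBl.
Qed.

End SVD.

(** * Closed forms for bias and variance, and the comparison with GD *)

Lemma dot_isometry (R : realType) (m n : nat) (V : 'M[R]_(m, n))
    (a b : 'cV[R]_n) :
  V^T *m V = 1%:M -> dot (V *m a) (V *m b) = dot a b.
Proof.
by move=> VV; rewrite /dot trmx_mul mulmxA -(mulmxA _ V^T) VV mulmx1.
Qed.

Lemma sam_propagator_diag (R : realType) (r : nat) (d : 'rV[R]_r)
    (eta rho : R) :
  1%:M - eta *: diag_mx d - (eta * rho) *: diag_mx d ^+ 2 =
  diag_mx (\row_i (1 - eta * d 0 i - eta * rho * d 0 i ^+ 2)).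
Proof.
rewrite diag_mxX; apply/matrixP => i j; rewrite !mxE.
by case: eqP => [->|_]; rewrite ?mulr1n ?mulr0n ?mulr0 ?subr0.
Qed.

(** Stated for any [rho], so that [rho = 0] covers GD. Iterates are frozen up to [k] inclusive
    because the prediction is read at [w_k]; ascent points enter only the steps [j < k]. *)
Lemma sam_bias2_vari (disp : measure_display)
    (Omega : measurableType disp) (R : realType) (P : probability Omega R)
    (L dim n : nat) (x : 'I_n -> 'cV[R]_dim) (ystar : 'I_n -> R)
    (eps : 'I_n -> {RV P >-> R}) (sigma eta rho : R)
    (w0 wbar : 'cV[R]_(L * dim)) (r n2 p2 : nat)
    (V1 : 'M[R]_(n, r)) (V2 : 'M[R]_(n, n2)) (s d : 'rV[R]_r)
    (U1 : 'M[R]_(L * dim, r)) (U2 : 'M[R]_(L * dim, p2)) (k : nat) :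
  let w om := sam x (noisy ystar eps om) eta rho w0 in
  let m := \row_i (1 - eta * d 0 i - eta * rho * d 0 i ^+ 2) in
  let u := U1^T *m (wbar - w0) in
  (forall i, 'E_P[eps i]%E = 0%:E) ->
  (forall i j,
     'E_P[(fun om => eps i om * eps j om)%R]%E = (sigma ^+ 2 *+ (i == j))%:E) ->
  (forall i, ystar i = dot (act w0 (x i)) wbar) ->
  is_svd (\matrix_(i < n) (act w0 (x i))^T) V1 V2 s U1 U2 ->
  diag_mx s ^+ 2 = diag_mx d ->
  {ae P, forall om, forall j i, (j <= k)%N ->
     act (w om j) (x i) = act w0 (x i)} ->
  {ae P, forall om, forall j i, (j < k)%N ->
     act (sam_ascent x (noisy ystar eps om) rho (w om j)) (x i) =
     act w0 (x i)} ->
  bias2 P x ystar (fun om => w om k) =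
    (n%:R^-1 * \sum_(i < r) m 0 i ^+ (2 * k) * d 0 i * u i 0 ^+ 2)%:E /\
  vari P x (fun om => w om k) =
    (sigma ^+ 2 / n%:R * \sum_(i < r) (1 - m 0 i ^+ k) ^+ 2)%:E.
Proof.
move=> w m u mean0 cov fit svdA hd actS actA.
set A := \matrix_(i < n) _ in svdA.
pose K := A *m A^T.
pose B := 1%:M - eta *: K - (eta * rho) *: K ^+ 2.
pose M : 'M[R]_r := 1%:M - eta *: diag_mx d - (eta * rho) *: diag_mx d ^+ 2.
have MkE : M ^+ k = diag_mx (\row_i m 0 i ^+ k).
  by rewrite /M sam_propagator_diag diag_mxX.
have Adot v i : (A *m v) i 0 = dot (act w0 (x i)) v.
  by rewrite mxE dotE; apply: eq_bigr => j _; rewrite !mxE.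
have [|-> ->] := @bias2_vari_affine _ _ _ P L dim n x ystar eps sigma
  (fun om => w om k) (B ^+ k *m (A *m (w0 - wbar))) (1%:M - B ^+ k) mean0 cov.
  apply: filterS2 actS actA => om actS actA i.
  have := @residual_sam R L dim n x (noisy ystar eps om) eta rho w0 A k erefl.
  move=> /(_ (fun j i jk => actS j i (ltnW jk)) actA) /=.
  rewrite -/K -/B -/(w om k).
  have -> : \col_i noisy ystar eps om i = A *m wbar + \col_i eps i om.
    by apply/colP => j; rewrite [RHS]mxE Adot -fit !mxE.
  move=> /(canRL (subrK _)).
  rewrite opprD [A *m w0 + _]addrA -mulmxBr.
  rewrite [B ^+ k *m (_ - \col_j _)]mulmxBr => wk.
  rewrite Phi_act actS// -Adot fit -Adot wk mulmxBl mul1mx addrACA.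
  by rewrite [_ + A *m wbar]addrC [_ + \col_j _]addrC [LHS]mxE [X in X + _]mxE.
split; congr (EFin (_ * _)).
  (* The sign comes from [u] being built on [wbar - w0]; it disappears in the squared norm, as does
     the isometry [V1]. *)
  have -> : B ^+ k *m (A *m (w0 - wbar)) = V1 *m - (M ^+ k *m diag_mx s *m u).
    rewrite {1}(svd_thin svdA) !mulmxA (svd_propagator_V1 svdA _ _ hd).
    by rewrite mulmxN -[w0 - wbar]opprB mulmxN !mulmxA.
  rewrite (dot_isometry _ _ (svd_V1_orthonormal svdA)) dotE MkE.
  rewrite mulmx_diag mul_diag_mx.
  apply: eq_bigr => i _; rewrite !mxE mulrNN -expr2 !exprMn.
  congr (_ * _ * _); first by rewrite -exprM mulnC.
  by have := congr1 (fun X : 'M[R]_r => X i i) hd; rewrite diag_mxX !mxE eqxx.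
rewrite (svd_propagatorC svdA _ _ hd) -/M.
set N := 1%:M - M ^+ k.
(* Cyclicity of the trace brings the outer [V1] and [V1^T] together, leaving the trace of
   [N^T N]. *)
rewrite !trmx_mul trmxK -!mulmxA (mulmxA V1^T) (svd_V1_orthonormal svdA) mul1mx.
rewrite mxtrace_mulC -!mulmxA (svd_V1_orthonormal svdA) mulmx1.
have -> : N = diag_mx (\row_i (1 - m 0 i ^+ k)).
  rewrite /N MkE; apply/matrixP => i j; rewrite !mxE.
  by case: eqP => [->|_]; rewrite ?mulr1n ?mulr0n ?subr0.
rewrite tr_diag_mx mulmx_diag mxtrace_diag; apply: eq_bigr => i _.
by rewrite !mxE expr2.
Qed.

Theorem theorem3
  (R : realType) (disp : measure_display) (Omega : measurableType disp)
  (P : probability Omega R)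
  (n dim L : nat)
  (* data and noise *)
  (x : 'I_n -> 'cV[R]_dim) (ystar : 'I_n -> R)
  (eps : 'I_n -> {RV P >-> R}) (sigma : R)
  (heps_indep : mutually_independent eps)
  (heps_mean : forall i, ('E_P[eps i])%E = 0%:E)
  (heps_cov : forall i j,
     ('E_P[(fun om => eps i om * eps j om)%R])%E = (sigma ^+ 2 *+ (i == j))%:E)
  (* algorithms *)
  (eta rho : R) (heta : 0 < eta) (hrho : 0 <= rho)
  (w0 : 'cV[R]_(L * dim))
  (* (A1), almost surely in the noise *)
  (kbar : nat) (hkbar : (1 <= kbar)%N)
  (hA1 : {ae P, forall om, forall (k : nat) (i : 'I_n), (k <= kbar)%N ->
     act (sam x (noisy ystar eps om) eta rho w0 k) (x i) = act w0 (x i) /\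
     act (gd x (noisy ystar eps om) eta w0 k) (x i) = act w0 (x i)})
  (* (A1) for the points at which SAM evaluates its outer gradient *)
  (hA1_ascent : {ae P, forall om, forall (k : nat) (i : 'I_n), (k < kbar)%N ->
     act (sam_ascent x (noisy ystar eps om) rho
            (sam x (noisy ystar eps om) eta rho w0 k)) (x i) = act w0 (x i)})
  (* (A2) *)
  (wbar : 'cV[R]_(L * dim))
  (hA2_act : forall i, act wbar (x i) = act w0 (x i))
  (hA2_fit : forall i, ystar i = dot (act wbar (x i)) wbar)
  (* singular value decomposition of A, with D_1 = Sigma_1^2 = diag(d) *)
  (A : 'M[R]_(n, L * dim)) (hA : A = \matrix_(i < n) (act w0 (x i))^T)
  (r n2 p2 : nat) (hr : \rank A = r)
  (V1 : 'M[R]_(n, r)) (V2 : 'M[R]_(n, n2)) (s : 'rV[R]_r)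
  (U1 : 'M[R]_(L * dim, r)) (U2 : 'M[R]_(L * dim, p2))
  (hsvd : is_svd A V1 V2 s U1 U2)
  (d : 'rV[R]_r) (hd : diag_mx s ^+ 2 = diag_mx d)
  (* hypotheses of the theorem *)
  (hw0 : w0 = U1 *m U1^T *m w0)
  (M : 'M[R]_r)
  (hM : M = 1%:M - eta *: diag_mx d - (eta * rho) *: diag_mx d ^+ 2)
  (hM_gt0 : loewner_lt 0 M) (hM_lt1 : loewner_lt M 1%:M)
  (u : 'cV[R]_r) (hu : u = U1^T *m (wbar - w0)) :
  let wSAM k om := sam x (noisy ystar eps om) eta rho w0 k in
  let wGD k om := gd x (noisy ystar eps om) eta w0 k in
  forall k : nat, (k <= kbar)%N ->
  [/\ bias2 P x ystar (wSAM k) =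
        (n%:R^-1 * \sum_(i < r)
           (1 - eta * d 0 i - eta * rho * d 0 i ^+ 2) ^+ (2 * k) *
           d 0 i * u i 0 ^+ 2)%:E,
      vari P x (wSAM k) =
        (sigma ^+ 2 / n%:R * \tr ((1%:M - M ^+ k) ^+ 2))%:E,
      (bias2 P x ystar (wSAM k) <= bias2 P x ystar (wGD k))%E &
      (vari P x (wSAM k) >= vari P x (wGD k))%E].
Proof.
move=> wSAM wGD k kkbar.
have fit i : ystar i = dot (act w0 (x i)) wbar by rewrite hA2_fit hA2_act.
have dE i : d 0 i = s 0 i ^+ 2.
  by have := congr1 (fun X : 'M[R]_r => X i i) hd; rewrite diag_mxX !mxE eqxx.
rewrite hA in hsvd.
have bias_vari rho' := @sam_bias2_vari _ _ _ P L dim n x ystar eps sigma eta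
  rho' w0 wbar r n2 p2 V1 V2 s d U1 U2 k heps_mean heps_cov fit hsvd hd.
have [||biasS variS] := bias_vari rho.
    apply: filterS hA1 => om act_om j i jk.
    by have [] := act_om j i (leq_trans jk kkbar).
  apply: filterS hA1_ascent => om act_om j i jk.
  exact: act_om (leq_trans jk kkbar).
have [||biasG variG] := bias_vari 0.
    apply: filterS hA1 => om act_om j i jk; rewrite -gd_sam0.
    by have [] := act_om j i (leq_trans jk kkbar).
  apply: filterS hA1 => om act_om j i jk.
  (* For [rho = 0] the ascent point is the iterate itself, so (A1) for GD suffices. *)
  rewrite /sam_ascent scale0r addr0 -gd_sam0.
  by have [] := act_om j i (leq_trans (ltnW jk) kkbar).
have wGDE : wGD k = fun om => sam x (noisy ystar eps om) eta 0 w0 k.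
  by apply/funext => om; exact: gd_sam0.
have wSAME : wSAM k = fun om => sam x (noisy ystar eps om) eta rho w0 k.
  reflexivity.
rewrite -wSAME in biasS variS.
rewrite -wGDE in biasG variG.
clearbody wSAM wGD; rewrite biasS variS biasG variG -hu.
pose mS i := 1 - eta * d 0 i - eta * rho * d 0 i ^+ 2.
have MkE : 1%:M - M ^+ k = diag_mx (\row_i (1 - mS i ^+ k)).
  rewrite hM sam_propagator_diag diag_mxX; apply/matrixP => i j; rewrite !mxE.
  by case: eqP => [->|_]; rewrite ?mulr1n ?mulr0n ?subr0.
have mS_gt0 i : 0 < mS i.
  have := loewner_lt_diag i hM_gt0.
  by rewrite hM sam_propagator_diag !mxE eqxx.
have d_gt0 i : 0 < d 0 i by have [_ _ s0 _] := hsvd; rewrite dE exprn_gt0.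
have mSG i : mS i <= 1 - eta * d 0 i.
  by rewrite gerBl mulr_ge0 ?mulr_ge0 ?sqr_ge0// ltW.
have mG_lt1 i : 1 - eta * d 0 i < 1 by rewrite gtrBl mulr_gt0.
split.
- by congr (EFin (_ * _)); apply: eq_bigr => i _; rewrite mxE.
- congr (EFin (_ * _)); rewrite MkE diag_mxX mxtrace_diag.
  by apply: eq_bigr => i _; rewrite !mxE.
(* Termwise: [0 < mS i <= 1 - eta d_i] is preserved by powers, and the weights [d_i u_i^2] are
   nonnegative. *)
- rewrite lee_fin ler_wpM2l ?invr_ge0//; apply: ler_sum => i _.
  rewrite !mxE mulr0 mul0r subr0 ler_wpM2r ?sqr_ge0//.
  rewrite ler_wpM2r ?(ltW (d_gt0 i))//.
  by rewrite lerXn2r ?nnegrE ?(ltW (mS_gt0 i)) ?mSG// (le_trans _ (mSG i)) ?ltW.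
(* Here the order reverses: [0 <= 1 - (1 - eta d_i)^k <= 1 - (mS i)^k], where the left bound makes
   squaring monotone. *)
- rewrite lee_fin; apply: ler_wpM2l.
    by rewrite mulr_ge0 ?sqr_ge0 ?invr_ge0.
  apply: ler_sum => i _.
  rewrite !mxE mulr0 mul0r subr0.
  have mG_ge0 : 0 <= 1 - eta * d 0 i by rewrite (le_trans _ (mSG i)) ?ltW.
  have mkSG : mS i ^+ k <= (1 - eta * d 0 i) ^+ k.
    by rewrite lerXn2r ?nnegrE ?(ltW (mS_gt0 i)).
  have mkG1 : (1 - eta * d 0 i) ^+ k <= 1 by rewrite exprn_ile1// ltW.
  by rewrite ler_sqr ?nnegrE ?subr_ge0 ?lerB// (le_trans mkSG).
Qed.
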